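(* Let $p$ and $q$ be real numbers with $p>2$ and $0<q<2$, and let $L_p=L_p(\mu)$ and $L_q=L_q(\nu)$ be infinite-dimensional, where $\mu$ and $\nu$ are measures on (possibly different) measurable spaces. Then $\mathcal{CR}(L_p,L_q)\le 30^{2/q}$.
   Context: For spaces $M_1,M_2$ with distances $d_1,d_2$ and an arbitrary (not necessarily continuous) map $\phi: M_1\to M_2$, define for $t\in(0,\infty)$ $$\kappa_\phi(t)=\inf_{d_1(x,y)\ge t} d_2(\phi(x),\phi(y)),\qquad \omega_\phi(t)=\sup_{d_1(x,y)\le t} d_2(\phi(x),\phi(y)),$$ with values in $[0,\infty]$, and $\kappa(\phi)=\sup_{t<\infty}\kappa_\phi(t)$, $\omega(\phi)=\inf_{t>0}\omega_\phi(t)$. The separation ratio of $\phi$ is $\mathcal{R}(\phi)=\kappa(\phi)/\omega(\phi)\in[0,\infty]$, with the conventions $\frac{a}{\infty}=\frac{0}{a}=0$ for all $a\in[0,\infty]$ and $\frac{a}{0}=\frac{\infty}{a}=\frac{\infty}{0}=\infty$ for all $a\in(0,\infty)$. The coarse embeddability ratio is $\mathcal{CR}(M_1,M_2)=\sup_\phi \mathcal{R}(\phi)$, the supremum over all maps $\phi:M_1\to M_2$. For $0<r<\infty$, $L_r(\mu)$ is the space of real-valued measurable functions $f$ (modulo $\mu$-a.e. equality) with $\|f\|_r=(\int|f|^r\,d\mu)^{1/r}<\infty$; for $r<1$ this is only a quasi-norm. In all cases (including $r<1$) the distance used in the definitions above is $\|f-g\|_r$. *)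

(* Defs.v *)
From HB Require Import structures.
From mathcomp Require Import all_boot all_order all_algebra.
From mathcomp Require Import all_classical all_reals all_analysis.

Set Implicit Arguments.
Unset Strict Implicit.
Unset Printing Implicit Defensive.
Import Order.TTheory GRing.Theory Num.Theory.
Import numFieldNormedType.Exports.

Local Open Scope classical_set_scope.
Local Open Scope ring_scope.
Local Open Scope ereal_scope.

Section separation_ratio.
Context (R : realType) (M1 M2 : Type).
(* Distances take values in \bar R so that (quasi-)norms given by integrals
   can be used without truncation. *)
Variables (dist1 : M1 -> M1 -> \bar R) (dist2 : M2 -> M2 -> \bar R).
Implicit Types (phi : M1 -> M2) (t : R).

(* The infimum over no pairs is +oo. *)
Definition kappa_at phi t : \bar R :=
  ereal_inf [set dist2 (phi xy.1) (phi xy.2) |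
             xy in [set xy : M1 * M1 | t%:E <= dist1 xy.1 xy.2]].

(* The supremum ranges over at least one pair as soon as M1 is inhabited. *)
Definition omega_at phi t : \bar R :=
  ereal_sup [set dist2 (phi xy.1) (phi xy.2) |
             xy in [set xy : M1 * M1 | dist1 xy.1 xy.2 <= t%:E]].

Definition kappa phi : \bar R :=
  ereal_sup [set kappa_at phi t | t in [set t : R | (0 < t)%R]].

Definition omega phi : \bar R :=
  ereal_inf [set omega_at phi t | t in [set t : R | (0 < t)%R]].

(* On [0, +oo] the division of \bar R satisfies a / +oo = 0 / a = 0 for all a
   (including +oo / +oo = 0 / 0 = 0), and a / 0 = +oo / b = +oo / 0 = +oo for
   0 < a < +oo and 0 < b < +oo. *)
Definition separation_ratio phi : \bar R := kappa phi / omega phi.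

Definition coarse_embeddability_ratio : \bar R :=
  ereal_sup [set separation_ratio phi | phi in [set: M1 -> M2]].

End separation_ratio.

Section Lr_space.
Context d (T : measurableType d) (R : realType).
Variables (mu : {measure set T -> \bar R}) (r : R).

(* LspaceType requires 1 <= r; this is the same quotient by mu-a.e. equality,
   restricted to classes of finite (quasi-)norm, for any exponent r. *)
Definition Lr : Type :=
  {f : {mfun_ mu, T >-> measurableTypeR R} | finite_norm mu r%:E f}.

(* A representative of the class; everything below is independent of it. *)
Definition Lr_fun (f : Lr) : T -> R := val f.

Definition Lr_dist (f g : Lr) : \bar R :=
  'N[mu]_r%:E[EFin \o (Lr_fun f \- Lr_fun g)%R].

(* No finite family spans the space. *)
Definition Lr_infinite_dimensional : Prop :=
  forall (n : nat) (f : 'I_n -> Lr), exists g : Lr, forall c : 'I_n -> R,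
    ~ (Lr_fun g = (fun x => (\sum_(i < n) c i * Lr_fun (f i) x)%R) %[ae mu]).

End Lr_space.

(* Main.v *)
(** Write [Z] for the cyclic group of order [4 l] and [n = l^2].  For a function
    [f] from [Z^n] to the reals, let [B_k f] be the average of [f] over the [2^k]
    translates by sums of the first [k] generators.  By the parallelogram law the
    square norm lost from [B_k f] to [B_(k+1) f] is a quarter of
    [|B_k f (. + e_k) - B_k f|^2], hence controls [|B_k f (. + l e_k) - B_k f|^2]
    up to a factor [l^2]; telescoping in [k], and comparing [f] with [B_k f],
    bounds the mean over [k] of [|f (. + l e_k) - f|^2] by 16 times a mean of
    [|f (. + g) - f|^2] over subset sums [g] of the generators.

    For [0 < q < 2] the kernel [|a - b|^q] is a positive mixture of squared
    Hilbert distances, so the same inequality holds with exponent [q] for real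
    functions and, by integration, for maps from [Z^n] to [L_q].  On the other
    hand [Z^n] maps into [L_p] in such a way that adding [l e_k] moves a point by
    at least [t], while adding a subset sum moves it by at most
    [t (2 n)^(1/p) / l], which tends to [0] since [p > 2].  Therefore
    [kappa^q <= 16 omega^q], and [16^(1/q) <= 30^(2/q)]. *)
From HB Require Import structures.
Require Import Defs.
From mathcomp Require Import all_boot all_order all_algebra.
From mathcomp Require Import all_classical all_reals all_analysis.
From mathcomp Require Import measurable_realfun ring lra zify.

Set Implicit Arguments.
Unset Strict Implicit.
Unset Printing Implicit Defensive.
Import Order.TTheory GRing.Theory Num.Theory.
Import numFieldNormedType.Exports.

Local Open Scope classical_set_scope.
Local Open Scope ring_scope.

(** * The quadratic inequality *)

(** Cauchy-Schwarz against the constant sequence 1; the inductive step reduces to the square of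
    [N * a i - S] being nonnegative. *)
Lemma sqr_sum_le (R : realFieldType) (I : Type) (r : seq I) (a : I -> R) :
  (\sum_(i <- r) a i) ^+ 2 <= (size r)%:R * \sum_(i <- r) a i ^+ 2.
Proof.
elim: r => [|i r IH]; first by rewrite !big_nil expr0n mulr0.
rewrite !big_cons /= -natr1.
case: r IH => [|j r] IH; first by rewrite !big_nil /=; lra.
have n0 : 0 < (size (j :: r))%:R :> R by rewrite ltr0n.
move: IH n0; set S := \sum_(_ <- _) _; set Q := \sum_(_ <- _) _.
set N : R := (size _)%:R => IH n0.
suff H : 2 * a i * S <= N * a i ^+ 2 + Q.
  rewrite [leLHS](_ : _ = a i ^+ 2 + 2 * a i * S + S ^+ 2); last by ring.
  by lra.
rewrite -(ler_pM2l n0).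
by have := sqr_ge0 (N * a i - S); lra.
Qed.

Section cube_walk.
Variables (R : realFieldType) (G : finZmodType) (s : nat -> G).
Implicit Types (f : G -> R) (K : G -> G -> R).

(** A list rather than a set: coinciding sums are counted with multiplicity, so there are always
    [2 ^ k] of them. *)
Fixpoint subset_sums k : seq G :=
  if k is j.+1 then subset_sums j ++ [seq s j + g | g <- subset_sums j]
  else [:: 0].

Lemma size_subset_sums k : size (subset_sums k) = (2 ^ k)%N.
Proof. by elim: k => //= k IH; rewrite size_cat size_map IH expnS mul2n addnn. Qed.

Definition walk_avg k f (x : G) : R :=
  (2 ^+ k)^-1 * \sum_(g <- subset_sums k) f (x + g).

Definition walk_energy k K : R :=
  (2 ^+ k)^-1 * \sum_(g <- subset_sums k) \sum_x K x (x + g).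

Definition sqnorm f : R := \sum_x f x ^+ 2.

Definition sqdist (f : G -> R) x y := (f x - f y) ^+ 2.

Lemma sum_shift f g : \sum_x f (x + g) = \sum_x f x.
Proof. by rewrite [RHS](reindex_inj (addIr g)). Qed.

Lemma walk_avg0 f x : walk_avg 0 f x = f x.
Proof. by rewrite /walk_avg /= big_seq1 addr0 expr0 invr1 mul1r. Qed.

Lemma walk_avgS k f x :
  walk_avg k.+1 f x = (walk_avg k f x + walk_avg k f (x + s k)) / 2.
Proof.
rewrite /walk_avg /= big_cat big_map /= exprS invfM.
under [in X in (_ + X)%R]eq_bigr do rewrite addrA.
by set a := \sum_(_ <- _) _; set b := \sum_(_ <- _) _; ring.
Qed.

Lemma walk_weight_neq0 k : (2 ^+ k : R) != 0.
Proof. by rewrite expf_neq0 ?pnatr_eq0. Qed.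

Lemma walk_avg_sub k f x :
  f x - walk_avg k f x = (2 ^+ k)^-1 * \sum_(g <- subset_sums k) (f x - f (x + g)).
Proof.
rewrite sumrB mulrBr -/(walk_avg k f x); congr (_ - _).
by rewrite big_const_seq count_predT size_subset_sums iter_addr_0 -[f x *+ _]mulr_natl
  natrX mulKf ?walk_weight_neq0.
Qed.

(** Convexity of the square: [f - walk_avg k f] is the average of the differences
    [f x - f (x + g)]. *)
Lemma sqnorm_sub_walk_avg k f :
  sqnorm (fun x => f x - walk_avg k f x) <= walk_energy k (sqdist f).
Proof.
rewrite /walk_energy exchange_big mulr_sumr; apply: ler_sum => x _.
rewrite walk_avg_sub exprMn expr2 -mulrA ler_pM2l ?invr_gt0 ?exprn_gt0//.
rewrite ler_pdivrMl ?exprn_gt0// -natrX -size_subset_sums.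
exact: sqr_sum_le.
Qed.

(** By translation invariance the energy is [2 |f|^2 - 2 <f, B>] with [B = walk_avg k f], so the gap
    between the two sides is exactly [|f - B|^2]. *)
Lemma sqnorm_walk_avg k f :
  sqnorm f - sqnorm (walk_avg k f) <= walk_energy k (sqdist f).
Proof.
suff -> : walk_energy k (sqdist f) =
    2 * sqnorm f - 2 * \sum_x f x * walk_avg k f x.
  rewrite /sqnorm !mulr_sumr -!sumrB; apply: ler_sum => x _.
  by have := sqr_ge0 (f x - walk_avg k f x); lra.
rewrite /walk_energy.
under eq_bigr => g _.
  under eq_bigr => x _ do rewrite /sqdist sqrrB.
  rewrite big_split sumrB /= (sum_shift (fun x => f x ^+ 2)).
  rewrite addrAC -mulr2n.
  over.
rewrite sumrB big_const_seq count_predT size_subset_sums iter_addr_0.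
rewrite mulrBr -[_ *+ (2 ^ k)]mulr_natl natrX mulKf ?walk_weight_neq0//.
rewrite mulr_natl; congr (_ - _).
rewrite exchange_big /= !mulr_sumr; apply: eq_bigr => x _.
by rewrite sumrMnl -mulr_sumr /walk_avg; ring.
Qed.

Lemma sqnorm_midpoint f g :
  \sum_x (f (x + g) - f x) ^+ 2 =
  4 * (sqnorm f - sqnorm (fun x => (f x + f (x + g)) / 2)).
Proof.
rewrite mulrBr.
have -> : 4 * sqnorm f = 2 * \sum_x f (x + g) ^+ 2 + 2 * \sum_x f x ^+ 2.
  by rewrite (sum_shift (fun x => f x ^+ 2)) /sqnorm; ring.
rewrite /sqnorm !mulr_sumr -big_split -sumrB /=; apply: eq_bigr => x _.
by field.
Qed.

(** Telescoping along [g] and Cauchy-Schwarz give one factor [l]; translation invariance makes the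
    [l] terms equal and gives the other. *)
Lemma sum_sqr_mulrn f g l :
  \sum_x (f (x + g *+ l) - f x) ^+ 2 <=
  l%:R ^+ 2 * \sum_x (f (x + g) - f x) ^+ 2.
Proof.
have H x : f (x + g *+ l) - f x =
    \sum_(i <- iota 0 l) (f (x + g *+ i + g) - f (x + g *+ i)).
  elim: l => [|l IH]; first by rewrite big_nil addr0 subrr.
  by rewrite -addn1 iotaD big_cat big_seq1 -IH add0n mulrnDr mulr1n (addrA x) /=; ring.
apply: (@le_trans _ _ (\sum_x l%:R *
    \sum_(i <- iota 0 l) (f (x + g *+ i + g) - f (x + g *+ i)) ^+ 2)).
  by apply: ler_sum => x _; rewrite H -{2}(size_iota 0 l) sqr_sum_le.
rewrite -mulr_sumr exchange_big /= expr2 -mulrA ler_wpM2l//.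
under eq_bigr do rewrite (sum_shift (fun x => (f (x + g) - f x) ^+ 2)).
by rewrite big_const_seq count_predT size_iota iter_addr_0 mulr_natl.
Qed.

(** Split [f = B + h] with [B] the average. The jump of [B] costs [l^2] times its single step, which
    [sqnorm_midpoint] equates with four times the norm lost; the jump of [h] costs at most
    [4 |h|^2], bounded through the energy. Squaring the sum doubles both, hence the two constants
    8. *)
Lemma sum_sqr_jump f k l :
  \sum_x sqdist f (x + s k *+ l) x <=
  8 * l%:R ^+ 2 * (sqnorm (walk_avg k f) - sqnorm (walk_avg k.+1 f)) +
  8 * walk_energy k (sqdist f).
Proof.
set B := walk_avg k f; set h := fun x => f x - B x; set t := s k *+ l.
have eB : sqnorm (walk_avg k.+1 f) = sqnorm (fun x => (B x + B (x + s k)) / 2).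
  by apply: eq_bigr => x _; rewrite walk_avgS.
have := sqnorm_sub_walk_avg k f; rewrite -/B -/h => he.
have := sum_sqr_mulrn B (s k) l; rewrite (sqnorm_midpoint B (s k)) -eB -/t => hB.
suff : \sum_x sqdist f (x + t) x <=
    2 * (\sum_x (B (x + t) - B x) ^+ 2) + 8 * sqnorm h by lra.
rewrite [8 * _](_ : _ = 4 * (\sum_x h (x + t) ^+ 2) + 4 * sqnorm h); last first.
  by rewrite (sum_shift (fun x => h x ^+ 2)) /sqnorm; ring.
rewrite /sqnorm !mulr_sumr -!big_split; apply: ler_sum => x _ /=.
rewrite /sqdist /h.
have := sqr_ge0 ((B (x + t) - B x) - ((f (x + t) - B (x + t)) - (f x - B x))).
have := sqr_ge0 ((f (x + t) - B (x + t)) + (f x - B x)).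
by lra.
Qed.

(* Telescoping the squared norms of the successive averages: a jump [s k *+ l]
   moves the average by at most [l] times the norm lost in the next averaging. *)
Lemma sum_sqr_jumps f n l :
  \sum_(k <- iota 0 n) \sum_x sqdist f (x + s k *+ l) x <=
  8 * l%:R ^+ 2 * walk_energy n (sqdist f) +
  8 * \sum_(k <- iota 0 n) walk_energy k (sqdist f).
Proof.
have l0 : 0 <= 8 * l%:R ^+ 2 :> R by rewrite mulr_ge0// exprn_ge0.
(* The induction runs on the total norm lost, which telescopes, instead of on the energy at [n] that
   dominates it. *)
apply: le_trans (lerD (ler_wpM2l l0 (sqnorm_walk_avg n f)) (lexx _)).
elim: n => [|n IH].
  rewrite !big_nil mulr0 addr0 mulr_ge0//.
  by rewrite (_ : sqnorm _ = sqnorm f) ?subrr//; apply: eq_bigr => x _; rewrite walk_avg0.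
rewrite -addn1 iotaD !big_cat !big_seq1 /= add0n addn1.
by have := sum_sqr_jump f n l; move: IH; lra.
Qed.

End cube_walk.

(** * Powers of distances as mixtures of squared distances *)

Section levy_khintchine.
Variable R : realType.
Implicit Types (a c q u x : R).
Local Notation mu := (@lebesgue_measure R).

Lemma lebesgue_measure_shift c (A : set R) : measurable A ->
  pushforward mu ((fun x => x + c) : _ -> measurableTypeR R) A = mu A.
Proof.
have mc : measurable_fun setT ((fun x => x + c) : R -> measurableTypeR R).
  exact: measurable_funD.
move=> mA; apply/esym/lebesgue_measure_unique => //= _ [[a b]] _ <-.
rewrite /pushforward /= (_ : _ @^-1` _ = `](a - c), (b - c)]%classic); last first.
  by apply/seteqP; split => x /=; rewrite !in_itv/= lerBrDr ltrBlDr.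
rewrite !lebesgue_measure_itv/= !lte_fin ltrD2r.
by case: ifP => // _; rewrite -!EFinB; congr EFin; ring.
Qed.

Lemma ge0_integral_shift c (f : R -> \bar R) :
  measurable_fun setT f -> (forall x, 0 <= f x)%E ->
  (\int[mu]_x f (x + c)%R = \int[mu]_x f x)%E.
Proof.
move=> mf f0.
have mc : measurable_fun setT ((fun x => x + c) : measurableTypeR R -> measurableTypeR R).
  exact: measurable_funD.
have := @ge0_integral_pushforward _ _ _ _ R _ mc mu setT f measurableT mf.
rewrite preimage_setT => <- //.
by apply: eq_measure_integral => /= A mA _; exact: lebesgue_measure_shift.
Qed.

Lemma ge0_integral_opp (f : R -> \bar R) :
  measurable_fun setT f -> (forall x, 0 <= f x)%E ->
  (\int[mu]_x f (- x)%R = \int[mu]_x f x)%E.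
Proof.
move=> mf f0.
have mN : measurable_fun setT (-%R : measurableTypeR R -> measurableTypeR R) by [].
have := @ge0_integral_pushforward _ _ _ _ R _ mN mu setT f measurableT mf.
rewrite preimage_setT => <- //.
by apply: eq_measure_integral => /= A mA _; exact: lebesgue_measureN.
Qed.

Lemma sqr_sin_le x : sin x ^+ 2 <= x ^+ 2.
Proof.
wlog x0 : x / 0 <= x.
  by move=> H; have [/H//|/ltW x0] := leP 0 x;
    rewrite -sqrrN -sinN -(sqrrN x); apply: H; rewrite oppr_ge0.
have [c _] : exists2 c, c \in `[0, x] & sin x - sin 0 = cos c * (x - 0).
  apply: (@MVT_segment R sin cos) => //.
  by apply: continuous_subspaceT; exact: continuous_sin.
rewrite sin0 !subr0 => ->; rewrite exprMn ler_piMl ?sqr_ge0//.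
Qed.

Lemma onemcos_le_sqr x : 1 - cos x <= x ^+ 2.
Proof.
have -> : x = (x / 2) *+ 2 by rewrite -mulr_natr; field.
rewrite cos_mulr2n; have := sqr_sin_le (x / 2); have := cos2Dsin2 (x / 2).
by have := sqr_ge0 (x / 2); lra.
Qed.

Lemma onemcos_ge0 x : 0 <= 1 - cos x.
Proof. by rewrite subr_ge0 cos_le1. Qed.

(* Up to the substitution [t = expR u], this is [(1 - cos (t a)) t^(- q - 1)] on
   the half-line; scaling in [t] becomes translation in [u]. *)
Definition lk_density q a u := (1 - cos (expR u * a)) * expR (- (q * u)).

Lemma lk_density_ge0 q a u : 0 <= lk_density q a u.
Proof. by rewrite mulr_ge0 ?onemcos_ge0 ?expR_ge0. Qed.

Lemma measurable_lk_density q a : measurable_fun setT (EFin \o lk_density q a).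
Proof.
have me : measurable_fun setT (@expR R).
  by apply: continuous_measurable_fun; exact: continuous_expR.
apply/measurable_EFinP; apply: measurable_funM.
  apply: measurable_funB => //; apply: measurableT_comp.
    by apply: continuous_measurable_fun; exact: continuous_cos.
  exact: measurable_funM.
by apply: measurableT_comp => //; apply: measurable_funN; exact: measurable_funM.
Qed.

Definition lk_const q : \bar R := (\int[mu]_u (lk_density q 1 u)%:E)%E.

(** For [a] nonzero, translating [u] by [ln |a|] turns the density at 1 into the density at [a]
    divided by [|a|^q]; evenness of the cosine absorbs the sign of [a]. *)
Lemma integral_lk_density q a : 0 < q ->
  (\int[mu]_u (lk_density q a u)%:E = (`|a| `^ q)%:E * lk_const q)%E.
Proof.
move=> q0; have [->|a0] := eqVneq a 0.
  rewrite normr0 powR0 ?gt_eqF// mul0e; apply: integral0_eq => u _.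
  by rewrite /lk_density mulr0 cos0 subrr mul0r.
have na0 : 0 < `|a| by rewrite normr_gt0.
rewrite /lk_const -(ge0_integral_shift (ln `|a|) (measurable_lk_density q 1)); last first.
  by move=> u; rewrite lee_fin lk_density_ge0.
rewrite -ge0_integralZl//; last 2 first.
- apply: (measurableT_comp (measurable_lk_density q 1)).
  exact: measurable_funD.
- by move=> u _; rewrite lee_fin lk_density_ge0.
apply: eq_integral => u _; rewrite -EFinM; congr EFin.
rewrite /lk_density mulr1 expRD lnK ?posrE// mulrCA; congr (_ * _).
  by rewrite -[in LHS]cos_norm normrM gtr0_norm ?expR_gt0.
by rewrite /powR gt_eqF// -expRD; congr expR; ring.
Qed.

(** The tails are dominated by multiples of exponential densities: [2 exp(- q u)] for [u >= 0], from
    [1 - cos x <= 2], and [exp((2 - q) u)] for [u < 0], from [1 - cos x <= x^2]. Each bound on [q]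
    makes one tail integrable. *)
Lemma lk_const_lty q : 0 < q -> q < 2 -> (lk_const q < +oo)%E.
Proof.
move=> q0 q2; have q2' : 0 < 2 - q by rewrite subr_gt0.
have mp (r : R) : measurable_fun setT (EFin \o exponential_pdf r).
  by apply/measurable_EFinP; exact: measurable_exponential_pdf.
have mpN (r : R) : measurable_fun setT (fun u => (exponential_pdf r (- u))%:E).
  by apply: (measurableT_comp (mp r)).
have p0 (r : R) (u : R) : 0 < r -> (0 <= (exponential_pdf r u)%:E)%E.
  by move=> r0; rewrite lee_fin exponential_pdf_ge0// ltW.
have i0 (r : R) : 0 < r -> (0 <= r^-1%:E)%E by move=> ?; rewrite lee_fin invr_ge0 ltW.
apply: (@le_lt_trans _ _ (\int[mu]_u ((2 / q)%:E * (exponential_pdf q u)%:E +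
    (2 - q)^-1%:E * (exponential_pdf (2 - q) (- u))%:E))%E).
  apply: ge0_le_integral => //.
  - by move=> u _; rewrite lee_fin lk_density_ge0.
  - exact: measurable_lk_density.
  - apply: emeasurable_funD; apply: measurable_funeM.
      exact: mp.
    exact: mpN.
  move=> u _; rewrite -!EFinM -EFinD lee_fin.
  have [u0|u0] := leP 0 u.
    rewrite (exponential_pdfE _ u0) -[leLHS]addr0 lerD//; last first.
      by rewrite mulr_ge0 ?invr_ge0 ?(ltW q2')// exponential_pdf_ge0// ltW.
    rewrite mulrA divfK ?gt_eqF// mulNr ler_wpM2r ?expR_ge0//.
    by have := cos_geN1 (expR u * 1); lra.
  rewrite [X in _ <= X + _](_ : _ = 0); last first.
    by rewrite lt0_exponential_pdf ?mulr0.
  have Nu0 : 0 <= - u by rewrite oppr_ge0 ltW.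
  rewrite (exponential_pdfE _ Nu0) mulrA mulVf ?gt_eqF// mul1r add0r.
  apply: (@le_trans _ _ (expR u ^+ 2 * expR (- (q * u)))).
    by rewrite /lk_density mulr1 ler_wpM2r ?expR_ge0// onemcos_le_sqr.
  by rewrite expr2 -!expRD (_ : u + u - q * u = - (2 - q) * - u)//; ring.
rewrite ge0_integralD//=; last 4 first.
- by move=> u _; rewrite mule_ge0 ?p0// lee_fin divr_ge0// ltW.
- by apply: measurable_funeM; exact: mp.
- by move=> u _; rewrite mule_ge0 ?p0// i0.
- by apply: measurable_funeM; exact: mpN.
rewrite !ge0_integralZl_EFin; last 8 first.
- exact: measurableT.
- by move=> u _; rewrite p0.
- exact: mpN.
- by rewrite invr_ge0 ltW.
- exact: measurableT.
- by move=> u _; rewrite p0.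
- exact: mp.
- by rewrite divr_ge0// ltW.
rewrite (ge0_integral_opp (mp _)); last by move=> u; rewrite p0.
by rewrite !integral_exponential_pdf// !mule1 -EFinD ltry.
Qed.

(** On [[-1, 0]] the point [expR u] lies in [[exp(-1), 1]], where the cosine decreases, so the
    density is at least [1 - cos (exp(-1))] there. *)
Lemma lk_const_gt0 q : 0 < q -> (0 < lk_const q)%E.
Proof.
move=> q0; set k : R := 1 - cos (expR (- 1)).
have pi1 : 1 <= pi :> R by apply: le_trans (pi_ge2 _); rewrite ler1n.
have e_in x : x <= 0 -> expR x \in `[0, pi].
  by move=> x0; rewrite in_itv/= expR_ge0 (le_trans _ pi1)// -expR0 ler_expR.
have k0 : 0 < k.
  rewrite subr_gt0 -[ltRHS]cos0 ltr_cos ?expR_gt0 ?e_in ?lerN10//.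
  by rewrite in_itv/= lexx pi_ge0.
apply: (@lt_le_trans _ _ (\int[mu]_(u in `[(- 1)%R, 0%R]) k%:E)%E).
  rewrite integral_cst//= lebesgue_measure_itv/= lte_fin ltrN10.
  by rewrite -EFinB -EFinM lte_fin mulr_gt0// sub0r opprK.
apply: (@le_trans _ _ (\int[mu]_(u in `[(- 1)%R, 0%R]) (lk_density q 1 u)%:E)%E).
  apply: ge0_le_integral => //.
  - by move=> u _; rewrite lee_fin ltW.
  - by apply: measurable_funTS; exact: measurable_lk_density.
  move=> u /=; rewrite in_itv/= => /andP[u1 u0]; rewrite lee_fin /lk_density mulr1.
  rewrite -[leLHS]mulr1 ler_pM ?(ltW k0)//.
    by rewrite lerD2l lerN2 leNgt ltr_cos ?e_in ?lerN10// -leNgt ler_expR.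
  by rewrite -expR0 ler_expR oppr_ge0 mulr_ge0_le0 ?(ltW q0).
apply: ge0_subset_integral => //.
- exact: measurable_lk_density.
- by move=> u _; rewrite lee_fin lk_density_ge0.
Qed.

End levy_khintchine.

(** * Inequalities between weighted sums of kernels *)

Section weighted_sum.
Variables (R : realType) (I : Type).
Implicit Types (r : seq (R * (I * I))) (K : I -> I -> R).

(** A list of weighted pairs acts as a linear functional on kernels; the same two lists are later
    tested on squares, [q]-th powers and constants. *)
Definition wsum r K : R := \sum_(i <- r) i.1 * K i.2.1 i.2.2.

Definition nonneg_weights r := all (fun i => 0 <= i.1) r.

Lemma wsumD r K1 K2 :
  wsum r (fun x y => K1 x y + K2 x y) = wsum r K1 + wsum r K2.
Proof. by rewrite -big_split; apply: eq_bigr => i _; rewrite mulrDr. Qed.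

Lemma wsumZ r K c : wsum r (fun x y => c * K x y) = c * wsum r K.
Proof. by rewrite mulr_sumr; apply: eq_bigr => i _; rewrite mulrCA. Qed.

Lemma wsum_ge0 r K : nonneg_weights r -> (forall x y, 0 <= K x y) -> 0 <= wsum r K.
Proof.
rewrite /wsum => r0 K0; elim: r r0 => [_|i r IH /= /andP[i0 r0]].
  by rewrite big_nil.
by rewrite big_cons addr_ge0 ?mulr_ge0// IH.
Qed.

Section integral.
Context d (T : measurableType d) (mu : {measure set T -> \bar R}).
Variable K : T -> I -> I -> R.
Hypothesis mK : forall x y, measurable_fun setT (fun t => K t x y).
Hypothesis K0 : forall t x y, 0 <= K t x y.

Lemma integral_wsum r : nonneg_weights r ->
  (\int[mu]_t (wsum r (K t))%:E =
   \sum_(i <- r) i.1%:E * \int[mu]_t (K t i.2.1 i.2.2)%:E)%E.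
Proof.
have mKE x y : measurable_fun setT (fun t => (K t x y)%:E) by exact/measurable_EFinP.
elim: r => [|i r IH] /= => [_|/andP[i0 r0]].
  by rewrite big_nil; apply: integral0_eq => t _; rewrite /wsum big_nil.
rewrite big_cons -IH// -ge0_integralZl_EFin//; last first.
  by move=> t _; rewrite lee_fin.
rewrite -ge0_integralD//.
- by apply: eq_integral => t _; rewrite /wsum big_cons.
- by move=> t _; rewrite mule_ge0// lee_fin.
- exact: measurable_funeM.
- by move=> t _; rewrite lee_fin wsum_ge0.
- by apply/measurable_EFinP/measurable_sum => j; exact: measurable_funM.
Qed.

Lemma integral_wsum_le r r' : nonneg_weights r -> nonneg_weights r' ->
  (forall t, wsum r (K t) <= wsum r' (K t)) ->
  (\sum_(i <- r) i.1%:E * \int[mu]_t (K t i.2.1 i.2.2)%:E <=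
   \sum_(i <- r') i.1%:E * \int[mu]_t (K t i.2.1 i.2.2)%:E)%E.
Proof.
move=> r0 r0' le_rr'; rewrite -!integral_wsum//.
have mw s : measurable_fun setT (fun t => (wsum s (K t))%:E).
  by apply/measurable_EFinP/measurable_sum => j; exact: measurable_funM.
by apply: ge0_le_integral => // t _; rewrite lee_fin ?wsum_ge0.
Qed.

End integral.

(* [|a|^q] is a positive mixture of the kernels [1 - cos (t a)], and
   [2 - 2 cos (t (x - y))] is the squared distance of two points of the circle. *)
Lemma wsum_powR_le (q : R) r r' : 0 < q -> q < 2 ->
  nonneg_weights r -> nonneg_weights r' ->
  (forall f : I -> R, wsum r (fun x y => (f x - f y) ^+ 2) <=
                      wsum r' (fun x y => (f x - f y) ^+ 2)) ->
  forall f : I -> R, wsum r (fun x y => `|f x - f y| `^ q) <=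
                     wsum r' (fun x y => `|f x - f y| `^ q).
Proof.
move=> q0 q2 r0 r0' H f.
pose K u x y := lk_density q (f x - f y) u.
have KE u x y : K u x y = 2^-1 * expR (- (q * u)) *
    ((cos (expR u * f x) - cos (expR u * f y)) ^+ 2 +
     (sin (expR u * f x) - sin (expR u * f y)) ^+ 2).
  rewrite /K /lk_density mulrBr cosB.
  have := cos2Dsin2 (expR u * f x); have := cos2Dsin2 (expR u * f y).
  set a := cos (_ * f x); set b := cos (_ * f y).
  set c := sin (_ * f x); set d := sin (_ * f y).
  set e := expR (- _) => h2 h1.
  transitivity (2^-1 * e * ((a ^+ 2 + c ^+ 2) + (b ^+ 2 + d ^+ 2) -
                            2 * a * b - 2 * c * d)); last by ring.
  by rewrite h1 h2; field.
have : forall u, wsum r (K u) <= wsum r' (K u).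
  move=> u; rewrite /wsum.
  under eq_bigr do rewrite KE.
  under [leRHS]eq_bigr do rewrite KE.
  rewrite -!/(wsum _ (fun x y => 2^-1 * expR (- (q * u)) * (
     (cos (expR u * f x) - cos (expR u * f y)) ^+ 2 +
     (sin (expR u * f x) - sin (expR u * f y)) ^+ 2))).
  rewrite !wsumZ !wsumD ler_wpM2l ?mulr_ge0 ?expR_ge0 ?invr_ge0//.
  by rewrite lerD// H.
have mK x y : measurable_fun setT (fun u => K u x y).
  by apply/measurable_EFinP; exact: measurable_lk_density.
have K0 u x y : 0 <= K u x y by exact: lk_density_ge0.
move=> /(integral_wsum_le (@lebesgue_measure R) mK K0 r0 r0').
(* Being finite and positive, the mixture constant can be cancelled from both sides. *)
have : lk_const q \is a fin_num.
  by rewrite ge0_fin_numE ?lk_const_lty// ltW// lk_const_gt0.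
case: (lk_const q) (lk_const_gt0 q0) (fun a => @integral_lk_density R q a q0) => // c.
rewrite lte_fin => c0 intE _.
have sumE s : (\sum_(i <- s) i.1%:E * \int[lebesgue_measure]_u (K u i.2.1 i.2.2)%:E =
    (wsum s (fun x y => `|f x - f y| `^ q) * c)%:E)%E.
  rewrite /wsum mulr_suml -sumEFin; apply: eq_bigr => i _.
  by rewrite intE -!EFinM mulrA.
by rewrite !sumE lee_fin ler_pM2r.
Qed.

End weighted_sum.

(** * The jump inequality as a comparison of two weighted lists *)

Section cube_inequality.
Variables (R : realType) (G : finZmodType) (s : nat -> G) (n l : nat).
Implicit Types (K : G -> G -> R).

Definition jumps : seq (R * (G * G)) :=
  [seq (1, (x + s k *+ l, x)) | k <- iota 0 n, x <- enum G].

Definition weighted_steps (c : R) k : seq (R * (G * G)) :=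
  [seq (c / 2 ^+ k, (x, x + g)) | g <- subset_sums s k, x <- enum G].

(** The weights are chosen so that [wsum_steps] reproduces the right-hand side of
    [sum_sqr_jumps]. *)
Definition steps : seq (R * (G * G)) :=
  weighted_steps (8 * l%:R ^+ 2) n ++
  flatten [seq weighted_steps 8 k | k <- iota 0 n].

Lemma wsum_jumps K :
  wsum jumps K = \sum_(k <- iota 0 n) \sum_x K (x + s k *+ l) x.
Proof.
rewrite /wsum big_allpairs_dep; apply: eq_bigr => k _.
by rewrite big_enum /=; apply: eq_bigr => x _; rewrite mul1r.
Qed.

Lemma wsum_weighted_steps c k K :
  wsum (weighted_steps c k) K = c * walk_energy s k K.
Proof.
rewrite /wsum big_allpairs_dep /walk_energy mulrA mulr_sumr; apply: eq_bigr => g _.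
by rewrite big_enum /= mulr_sumr.
Qed.

Lemma wsum_steps K : wsum steps K =
  8 * l%:R ^+ 2 * walk_energy s n K +
  8 * \sum_(k <- iota 0 n) walk_energy s k K.
Proof.
rewrite /wsum big_cat /=; congr (_ + _); first exact: wsum_weighted_steps.
rewrite big_flatten big_map mulr_sumr; apply: eq_bigr => k _.
exact: wsum_weighted_steps.
Qed.

Lemma jumps_nonneg : nonneg_weights jumps.
Proof. by apply/allP => _ /allpairsP[[k x] [_ _ ->]] /=. Qed.

Lemma steps_nonneg : nonneg_weights steps.
Proof.
have w c k : 0 <= c -> nonneg_weights (weighted_steps c k).
  move=> c0; apply/allP => _ /allpairsP[[g x] [_ _ ->]] /=.
  by rewrite divr_ge0// exprn_ge0.
rewrite /nonneg_weights all_cat [X in X && _]w ?mulr_ge0 ?exprn_ge0//=.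
by apply/allP => i /flatten_mapP[k _]; exact: (allP (w 8 k _)).
Qed.

Lemma mem_jumps i : i \in jumps ->
  exists2 k, (k < n)%N & i.2.1 = i.2.2 + s k *+ l.
Proof.
by move=> /allpairsP[[k x] [+ _ ->]]; rewrite mem_iota => /= kn; exists k.
Qed.

Lemma mem_steps i : i \in steps ->
  exists k g, [/\ (k <= n)%N, g \in subset_sums s k & i.2.2 = i.2.1 + g].
Proof.
rewrite mem_cat => /orP[/allpairsP[[g x] [gs _ ->]]|]; first by exists n, g.
move=> /flatten_mapP[k]; rewrite mem_iota => /= kn /allpairsP[[g x] [gs _ ->]].
by exists k, g; split => //; exact: ltnW.
Qed.

Lemma wsum_jumps_steps_sqr (f : G -> R) :
  wsum jumps (fun x y => (f x - f y) ^+ 2) <=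
  wsum steps (fun x y => (f x - f y) ^+ 2).
Proof. by rewrite wsum_jumps wsum_steps; exact: sum_sqr_jumps. Qed.

Lemma wsum_jumps1 : wsum jumps (fun _ _ => 1) = (n * #|G|)%:R.
Proof.
rewrite wsum_jumps sumr_const big_const_seq count_predT size_iota iter_addr_0.
by rewrite -mulrnA mulnC.
Qed.

Lemma walk_energy1 k : walk_energy s k (fun _ _ => 1 : R) = #|G|%:R.
Proof.
rewrite /walk_energy sumr_const big_const_seq count_predT size_subset_sums.
by rewrite iter_addr_0 -[_ *+ (2 ^ k)]mulr_natl natrX mulKf ?walk_weight_neq0.
Qed.

(** Total mass, to be compared with [wsum_jumps1]: for [n = l^2] the ratio of the two is 16, the
    constant of the final bound. *)
Lemma wsum_steps1 :
  wsum steps (fun _ _ => 1) = (8 * (l ^ 2 + n) * #|G|)%:R.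
Proof.
rewrite wsum_steps walk_energy1.
under eq_bigr do rewrite walk_energy1.
rewrite big_const_seq count_predT size_iota iter_addr_0 !natrM natrD natrX.
by rewrite -mulr_natl; ring.
Qed.

End cube_inequality.

Section weighted_bounds.
Variables (R : realType) (I : eqType).
Implicit Types (r : seq (R * (I * I))) (K : I -> I -> \bar R) (b : \bar R).
Local Open Scope ereal_scope.

Lemma wsum_cst r b : nonneg_weights r ->
  (wsum r (fun _ _ => 1%R))%:E * b = \sum_(i <- r) i.1%:E * b.
Proof.
elim: r => [_|i r IH /= /andP[i0 r0]]; first by rewrite /wsum !big_nil mul0e.
rewrite big_cons -IH// -ge0_muleDl ?lee_fin//; last by rewrite wsum_ge0.
by rewrite /wsum big_cons mulr1 EFinD.
Qed.

Lemma wsum_ge_cst r K b : nonneg_weights r ->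
  {in r, forall i, b <= K i.2.1 i.2.2} ->
  (wsum r (fun _ _ => 1%R))%:E * b <= \sum_(i <- r) i.1%:E * K i.2.1 i.2.2.
Proof.
move=> r0 bK; rewrite wsum_cst// big_seq [leRHS]big_seq; apply: lee_sum => i ir.
by rewrite lee_wpmul2l ?bK// lee_fin; exact: (allP r0).
Qed.

Lemma wsum_le_cst r K b : nonneg_weights r ->
  {in r, forall i, K i.2.1 i.2.2 <= b} ->
  \sum_(i <- r) i.1%:E * K i.2.1 i.2.2 <= (wsum r (fun _ _ => 1%R))%:E * b.
Proof.
move=> r0 bK; rewrite wsum_cst// big_seq [leRHS]big_seq; apply: lee_sum => i ir.
by rewrite lee_wpmul2l ?bK// lee_fin; exact: (allP r0).
Qed.

End weighted_bounds.

(** * The discrete torus *)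

Section torus.
Variables (R : realType) (n l : nat).
Hypothesis l0 : (0 < l)%N.

(** The distance from [z] to the nearest multiple of [4 * l]: a periodic zigzag of height
    [2 * l]. *)
Definition tent (z : nat) : nat := minn (z %% (4 * l)) (4 * l - z %% (4 * l)).

Lemma tent_mod y z : tent (y %% (4 * l) + z) = tent (y + z).
Proof. by rewrite /tent modnDml. Qed.

Lemma tent_small z : (z < 4 * l)%N -> tent z = minn z (4 * l - z).
Proof. by move=> zl; rewrite /tent modn_small. Qed.

Lemma tent_wrap z : (z < 4 * l)%N -> tent (4 * l + z) = minn z (4 * l - z).
Proof. by move=> zl; rewrite /tent modnDl modn_small. Qed.

Lemma tentS z : (tent z <= (tent z.+1).+1)%N /\ (tent z.+1 <= (tent z).+1)%N.
Proof.
have -> : tent z.+1 = tent (z %% (4 * l)).+1.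
  by rewrite -(addn1 z) -(addn1 (z %% _)) tent_mod.
have -> : tent z = tent (z %% (4 * l)) by rewrite /tent modn_mod.
have : (z %% (4 * l) < 4 * l)%N by rewrite ltn_mod muln_gt0.
move: (z %% _)%N => y yl; rewrite (tent_small yl).
have [yl'|] := ltnP y.+1 (4 * l); first by rewrite (tent_small yl'); lia.
move=> yl'; have -> : y.+1 = (4 * l + 0)%N by lia.
by rewrite tent_wrap; lia.
Qed.

(** The tent has slope 1 or -1 on each half period. From the first and third quarters a step by [l]
    stays in the same half; from the second and fourth, the preliminary shift by [l] leads to the
    third and first. *)
Lemma tent_jump z : exists b : bool,
  (tent (z + b * l + l) + l = tent (z + b * l))%N \/
  (tent (z + b * l) + l = tent (z + b * l + l))%N.
Proof.
suff : exists b : bool,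
  (tent (z %% (4 * l) + (b * l + l)) + l = tent (z %% (4 * l) + b * l))%N \/
  (tent (z %% (4 * l) + b * l) + l = tent (z %% (4 * l) + (b * l + l)))%N.
  by move=> [b]; rewrite !tent_mod addnA => H; exists b.
have : (z %% (4 * l) < 4 * l)%N by rewrite ltn_mod muln_gt0.
move: (z %% _)%N => y yl.
have [y1|y1] := ltnP y l.
  by exists false; rewrite !tent_small; lia.
have [y2|y2] := ltnP y (2 * l).
  by exists true; rewrite !tent_small; lia.
have [y3|y3] := ltnP y (3 * l).
  by exists false; rewrite !tent_small; lia.
exists true; have [w wl ->] : exists2 w, (w < l)%N & y = (3 * l + w)%N.
  by exists (y - 3 * l)%N; lia.
rewrite mul1n (_ : 3 * l + w + l = 4 * l + w)%N; last by lia.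
rewrite (_ : 3 * l + w + (l + l) = 4 * l + (w + l))%N; last by lia.
by rewrite !tent_wrap; lia.
Qed.

Definition torus := 'rV['Z_(4 * l)]_n.

Definition torus_gen (k : nat) : torus := \row_j (j == k :> nat)%:R.

(* The tents at [z] and [z + l] are a quarter period apart, so for every [z] one
   of them changes by the full [l] under [z -> z + l]. *)
Definition torus_map (x : torus) (i : 'I_n * bool) : R :=
  (tent (x 0 i.1 + i.2 * l))%:R.

Lemma torus_mapD (x g : torus) i m : g 0 i.1 = m%:R ->
  torus_map (x + g) i = (tent (x 0 i.1 + i.2 * l + m))%:R.
Proof.
move=> gm; rewrite /torus_map mxE gm; congr (_%:R).
(* ['Z_m] has [m] elements only when [m > 1]. *)
have l1 : (1 < 4 * l)%N by lia.
rewrite /= val_Zp_nat//; move: (nat_of_ord (x 0 i.1)) => a; rewrite Zp_cast//.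
by rewrite tent_mod -addnA (addnC a) -addnA tent_mod; congr tent; lia.
Qed.

(** The vanishing of the coordinates from [k] on carries the induction: generator [k] is added to a
    zero coordinate, so no coordinate exceeds 1. *)
Lemma subset_sums_torus_gen k g : g \in subset_sums torus_gen k ->
  forall j : 'I_n, exists b : bool, g 0 j = b%:R /\ ((k <= j)%N -> b = false).
Proof.
elim: k g => [|k IH] g /=.
  by rewrite inE => /eqP -> j; exists false; rewrite mxE.
rewrite mem_cat => /orP[/IH gP j|/mapP[h /IH hP ->] j].
  by have [b [-> b0]] := gP j; exists b; split => // /ltnW.
have [b [hb b0]] := hP j; rewrite !mxE hb.
have [jk|jk] := eqVneq (j : nat) k.
  by exists true; rewrite b0 ?jk// addr0; split => //; rewrite ltnn.
by exists b; rewrite add0r; split => // /ltnW.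
Qed.

Lemma torus_map_step k (g x : torus) i : g \in subset_sums torus_gen k ->
  `|torus_map (x + g) i - torus_map x i| <= 1.
Proof.
move=> /subset_sums_torus_gen/(_ i.1)[b [gb _]].
rewrite (torus_mapD _ gb) /torus_map; set z := (x 0%R i.1 + i.2 * l)%N.
rewrite ler_norml; have [H1 H2] := tentS z.
move: H1 H2; rewrite -!(ler_nat R) -!natr1.
case: b gb => _; rewrite ?addn1 ?addn0 ?subrr; lra.
Qed.

Lemma torus_map_jump k (x : torus) : (k < n)%N ->
  exists i, `|torus_map (x + torus_gen k *+ l) i - torus_map x i| = l%:R.
Proof.
move=> kn; pose j := Ordinal kn.
have [b H] := tent_jump (x 0 j).
exists (j, b); rewrite (@torus_mapD _ _ _ l); last first.
  by rewrite mulmxnE mxE eqxx.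
rewrite /torus_map /=; case: H => [<-|<-]; rewrite natrD.
  by rewrite opprD addrA subrr add0r normrN normr_nat.
by rewrite addrC addKr normr_nat.
Qed.

End torus.

(** * Sequence spaces inside [L_r] *)

Section Lr_basics.
Context d (T : measurableType d) (R : realType).
Variables (mu : {measure set T -> \bar R}) (r : R).
Hypothesis r0 : 0 < r.

Lemma measurable_powR_norm (f : T -> R) :
  measurable_fun setT f -> measurable_fun setT (fun x => `|f x| `^ r).
Proof.
move=> mf; apply: (@measurableT_comp _ _ _ _ _ _ (@powR R ^~ r)) => //.
exact: measurableT_comp.
Qed.

Lemma Lnorm_ae_eq (f g : T -> R) :
  measurable_fun setT f -> measurable_fun setT g -> f = g %[ae mu] ->
  ('N[mu]_r%:E[EFin \o f] = 'N[mu]_r%:E[EFin \o g])%E.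
Proof.
move=> mf mg fg; rewrite unlock; congr (_ `^ _)%E.
apply: ge0_ae_eq_integral => //.
- by apply/measurable_EFinP; exact: measurable_powR_norm.
- by apply/measurable_EFinP; exact: measurable_powR_norm.
- by move=> x _; exact: poweR_ge0.
- by move=> x _; exact: poweR_ge0.
by apply: filterS fg => x /= /[apply] ->.
Qed.

Lemma measurable_Lr_fun (f : Lr mu r) : measurable_fun setT (Lr_fun f).
Proof. exact: (measurable_funPT (repr (val f))). Qed.

Lemma Lr_class (f : T -> R) : measurable_fun setT f -> finite_norm mu r%:E f ->
  exists F : Lr mu r, Lr_fun F = f %[ae mu].
Proof.
move=> mf nf.
pose h : {mfun T >-> measurableTypeR R} :=
  HB.pack (f : T -> measurableTypeR R)
          (@isMeasurableFun.Build _ _ T (measurableTypeR R) f mf).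
pose F : {mfun_ mu, T >-> measurableTypeR R} :=
  (\pi_({mfun_ mu, T >-> measurableTypeR R}) h)%qT.
have Fh : (F : T -> R) = f %[ae mu].
  have : ae_eq_op mu (repr F) h by rewrite -eqmodE reprK.
  by move/asboolP.
have nF : finite_norm mu r%:E F.
  rewrite /finite_norm (Lnorm_ae_eq _ mf Fh)//.
  exact: (measurable_funPT (repr F)).
by exists (exist _ F nF).
Qed.

Lemma powR_Lr_dist (f g : Lr mu r) :
  (Lr_dist f g `^ r = \int[mu]_x (`|Lr_fun f x - Lr_fun g x| `^ r)%:E)%E.
Proof. by rewrite /Lr_dist powR_Lnorm ?gt_eqF. Qed.

End Lr_basics.

(** * Atoms and disjoint sets of finite positive measure *)

Section atoms.
Context d (T : measurableType d) (R : realType).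
Variable mu : {measure set T -> \bar R}.

Lemma exists_natr_gt (x : R) : exists k : nat, x < k.+1%:R.
Proof.
exists (Num.truncn `|x|); apply: le_lt_trans (ler_norm x) _.
by have /truncn_itv/andP[] : 0 <= `|x| by [].
Qed.

Lemma exists_invn_lt (x : R) : 0 < x -> exists k : nat, k.+1%:R^-1 < x.
Proof.
move=> x0; have [k kx] := exists_natr_gt x^-1; exists k.
by rewrite invf_plt ?posrE.
Qed.

(** The constant is the infimum of the levels [t] with [g <= t] almost everywhere on [A]; as [A] is
    not negligible, these levels form a nonempty set bounded below. *)
Lemma ae_constant_on (A : set T) (g : T -> R) :
  ~ mu.-negligible A ->
  (forall t, mu.-negligible (A `&` [set x | t < g x]) \/
             mu.-negligible (A `&` [set x | g x <= t])) ->
  exists c, mu.-negligible (A `&` [set x | g x != c]).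
Proof.
move=> nA dich.
pose S := [set t | mu.-negligible (A `&` [set x | t < g x])].
have S_up t t' : S t -> t <= t' -> S t'.
  move=> St tt'; apply: negligibleS St => x /= [Ax gx]; split => //.
  exact: le_lt_trans gx.
have S0 : S !=set0.
  apply: contrapT => /nonemptyPn S0; apply: nA.
  apply: (@negligibleS _ _ _ _ (\bigcup_k (A `&` [set x | g x <= k.+1%:R]))).
    move=> x Ax; have [k gk] := exists_natr_gt (g x); exists k => //.
    by split => //=; exact: ltW.
  apply: negligible_bigcup => k; have [Sk|//] := dich k.+1%:R.
  by have : (set0 : set R) k.+1%:R by rewrite -S0.
have lS : has_lbound S.
  apply: contrapT => nlS; apply: nA.
  apply: (@negligibleS _ _ _ _ (\bigcup_k (A `&` [set x | - k.+1%:R < g x]))).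
    move=> x Ax; have [k gk] := exists_natr_gt (- g x); exists k => //; split => //=.
    by rewrite ltrNl.
  apply: negligible_bigcup => k; apply: contrapT => nSk; apply: nlS.
  exists (- k.+1%:R) => t St; rewrite leNgt; apply/negP => tk; apply: nSk.
  exact: S_up (ltW tk).
exists (inf S).
apply: (@negligibleS _ _ _ _ (\bigcup_k (A `&` [set x | inf S + k.+1%:R^-1 < g x]) `|`
   \bigcup_k (A `&` [set x | g x <= inf S - k.+1%:R^-1]))).
  move=> x [Ax /= gx]; case: (ltgtP (g x) (inf S)) gx => // gx _.
    right; have [|k kx] := @exists_invn_lt (inf S - g x); first by rewrite subr_gt0.
    by exists k => //; split => //=; rewrite lerBrDl -lerBrDr ltW.
  left; have [|k kx] := @exists_invn_lt (g x - inf S); first by rewrite subr_gt0.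
  by exists k => //; split => //=; rewrite -ltrBrDl.
have k0 k : 0 < k.+1%:R^-1 :> R by rewrite invr_gt0.
apply: negligibleU; apply: negligible_bigcup => k.
  have [t St tk] := inf_adherent (k0 k) (conj S0 lS).
  exact: S_up St (ltW tk).
have [Sk|//] := dich (inf S - k.+1%:R^-1).
by have := ge_inf lS Sk; rewrite lerBrDl gerDr leNgt k0.
Qed.


(** Indexing by [nat], with measure and disjointness constrained only below [n], lets a family grow
    without a change of index type. *)
Definition pos_disjoint n (A : nat -> set T) :=
  [/\ forall i, measurable (A i),
      forall i, (i < n)%N -> (0 < mu (A i) < +oo)%E &
      forall i j x, (i < n)%N -> (j < n)%N -> A i x -> A j x -> i = j].

Lemma pos_disjoint_split n A i B : pos_disjoint n A -> (i < n)%N -> measurable B ->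
  ~ mu.-negligible (A i `&` B) -> ~ mu.-negligible (A i `\` B) ->
  exists A', pos_disjoint n.+1 A'.
Proof.
move=> [mA pA dA] lt_in mB n1 n2.
pose A' j := if j == n then A i `\` B else if j == i then A i `&` B else A j.
have mI : measurable (A i `&` B) by exact: measurableI.
have mD : measurable (A i `\` B) by exact: measurableD.
have pos C : measurable C -> ~ mu.-negligible C -> C `<=` A i ->
    (0 < mu C < +oo)%E.
  move=> mC nC CA; have /andP[_ Ai] := pA _ lt_in.
  rewrite (le_lt_trans _ Ai) ?le_measure ?inE// andbT lt_neqAle measure_ge0 andbT.
  by apply/eqP => C0; apply: nC; apply/negligibleP.
have A'A j x : A' j x -> (j < n)%N -> A j x.
  rewrite /A'; case: eqP => [->|_]; first by rewrite ltnn.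
  by case: eqP => [->[]|].
exists A'; split => [j|j|].
- by rewrite /A'; case: ifP => // _; case: ifP.
- rewrite ltnS leq_eqVlt /A'; case: eqP => [_ _|_ /=].
    by apply: pos => // x [].
  by case: eqP => [_ _|_]; [apply: pos => // x []|exact: pA].
have key j x : (j < n)%N -> A' j x -> A' n x -> False.
  rewrite /A' eqxx; case: eqP => [->|_]; first by rewrite ltnn.
  case: eqP => [_ _ [_ Bx] []//|ji jn Ajx [Aix _]].
  by apply: ji; exact: (dA _ _ x).
move=> j k x; rewrite !ltnS (leq_eqVlt j) (leq_eqVlt k).
move=> /predU1P[->|jn] /predU1P[->|kn]//.
- by move=> A'n A'k; have := key _ _ kn A'k A'n.
- by move=> A'j A'n; have := key _ _ jn A'j A'n.
- by move=> A'j A'k; apply: (dA _ _ x) => //; exact: A'A.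
Qed.

Lemma pos_disjoint_extend n A B : pos_disjoint n A -> measurable B ->
  (0 < mu B < +oo)%E -> (forall i, (i < n)%N -> A i `&` B = set0) ->
  exists A', pos_disjoint n.+1 A'.
Proof.
move=> [mA pA dA] mB pB AB.
have key i x : (i < n)%N -> A i x -> B x -> False.
  by move=> /AB AB0 Aix Bx; rewrite -[False]/(set0 x) -AB0.
exists (fun j => if j == n then B else A j); split => [j|j|j k x].
- by case: ifP.
- by rewrite ltnS leq_eqVlt; case: eqP => //= _; exact: pA.
rewrite !ltnS (leq_eqVlt j) (leq_eqVlt k).
case: (eqVneq j n) => [->|jn] /=; case: (eqVneq k n) => [->|kn]//=.
- by move=> _ kn' Bx Akx; have := key _ _ kn' Akx Bx.
- by move=> jn' _ Ajx Bx; have := key _ _ jn' Ajx Bx.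
- exact: dA.
Qed.

(** Chebyshev: [a^r] times this measure is at most the integral of [|g|^r]. *)
Lemma Lr_superlevel_lty (r : R) (g : T -> R) (a : R) : 0 < r -> 0 < a ->
  measurable_fun setT g -> finite_norm mu r%:E g ->
  (mu [set x | (a <= `|g x|)%R] < +oo)%E.
Proof.
move=> r0 a0 mg ng.
have mN := measurable_powR_norm r mg.
have mS : measurable [set x | (a <= `|g x|)%R].
  rewrite -[X in measurable X]setTI; apply: measurable_fun_ler => //.
  exact: measurableT_comp.
have ar : 0 < a `^ r by rewrite powR_gt0.
suff : ((a `^ r)%:E * mu [set x | (a <= `|g x|)%R] < +oo)%E.
  case: (mu _) (measure_ge0 mu [set x | (a <= `|g x|)%R]) => //.
    by move=> ? _ _; rewrite ltry.
  by rewrite mulry gtr0_sg// mul1e.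
apply: (@le_lt_trans _ _ (\int[mu]_x (`|g x| `^ r)%:E)%E).
  rewrite -integral_cst//.
  apply: (@le_trans _ _ (\int[mu]_(x in [set x | (a <= `|g x|)%R]) (`|g x| `^ r)%:E)%E).
    apply: ge0_le_integral => //.
    - by move=> x _; rewrite lee_fin powR_ge0.
    - by apply/measurable_EFinP; exact: measurable_funTS.
    - by move=> x /= ax; rewrite lee_fin ge0_ler_powR ?nnegrE ?(ltW a0) ?(ltW r0).
  apply: ge0_subset_integral => //; exact/measurable_EFinP.
rewrite -(poweR_Lnorm mu (EFin \o g) (lt0r_neq0 r0)).
by apply: poweR_lty.
Qed.

End atoms.

(** * Step functions over disjoint sets *)

Section step_functions.
Context d (T : measurableType d) (R : realType).
Variable mu : {measure set T -> \bar R}.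
Variables (r : R) (n : nat) (A : nat -> set T).
Hypothesis r0 : 0 < r.
Hypothesis dA : pos_disjoint mu n A.

Definition step_fun (u : 'I_n -> R) (x : T) : R := \sum_(i < n) u i * \1_(A i) x.

Lemma step_fun_in u x (i : 'I_n) : A i x -> step_fun u x = u i.
Proof.
have [_ _ disj] := dA => Aix.
rewrite /step_fun (bigD1 i)//= indicE mem_set// mulr1 big1 ?addr0// => j ji.
rewrite indicE memNset ?mulr0// => Ajx.
by case/eqP: ji; apply: val_inj; exact: (disj _ _ x (ltn_ord j) (ltn_ord i)).
Qed.

Lemma step_fun_out u x : (forall i : 'I_n, ~ A i x) -> step_fun u x = 0.
Proof. by move=> nA; rewrite /step_fun big1// => i _; rewrite indicE memNset ?mulr0. Qed.

Lemma measurable_step_fun u : measurable_fun setT (step_fun u).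
Proof.
have [mA _ _] := dA; apply: measurable_sum => i.
by apply: measurable_funM => //; exact: measurable_indic.
Qed.

Lemma powR_step_fun u x :
  `|step_fun u x| `^ r = step_fun (fun i => `|u i| `^ r) x.
Proof.
have [[i Aix]|nA] := pselect (exists i : 'I_n, A i x).
  by rewrite !(step_fun_in _ Aix).
have nA' (i : 'I_n) : ~ A i x by move=> Aix; apply: nA; exists i.
by rewrite !step_fun_out// normr0 powR0// gt_eqF.
Qed.

Lemma integral_powR_step_fun u :
  (\int[mu]_x (`|step_fun u x| `^ r)%:E =
   \sum_(i < n) (`|u i| `^ r)%:E * mu (A i))%E.
Proof.
have [mA _ _] := dA.
under eq_integral do rewrite powR_step_fun /step_fun -sumEFin.
rewrite ge0_integral_sum//; last first.
  by move=> i; apply/measurable_EFinP; apply: measurable_funM => //.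
apply: eq_bigr => i _; under eq_integral do rewrite EFinM.
rewrite ge0_integralZl_EFin ?powR_ge0//; last first.
  by apply/measurable_EFinP; exact: measurable_indic.
by rewrite integral_indic// setIT.
Qed.

Lemma finite_norm_step_fun u : finite_norm mu r%:E (step_fun u).
Proof.
rewrite /finite_norm unlock; apply: poweR_lty.
have [_ pA _] := dA.
rewrite [ltLHS](_ : _ = \int[mu]_x (`|step_fun u x| `^ r)%:E)%E//.
rewrite integral_powR_step_fun; apply: lte_sum_pinfty => i _.
have /andP[_ Ai] := pA _ (ltn_ord i).
by rewrite lte_mul_pinfty// ?lee_fin ?powR_ge0.
Qed.

End step_functions.

(** * Finite-dimensional [l_r] spaces from infinite dimension *)

Section pos_disjoint_exist.
Context d (T : measurableType d) (R : realType).
Variable mu : {measure set T -> \bar R}.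
Variable r : R.
Hypothesis r0 : 0 < r.
Hypothesis hinf : Lr_infinite_dimensional mu r.

(** Suppose a family of [n] sets cannot be enlarged. Then no level of a function [g] splits any
    [A i], so [g] is almost everywhere constant on each. Off the union, the sets where [|g|] is at
    least [1/(k+1)] have finite measure, hence are null. So [g] is a combination of [n] indicators,
    against infinite dimension. *)
Lemma exists_pos_disjoint n : exists A, pos_disjoint mu n A.
Proof.
elim: n => [|n [A dA]]; first by exists (fun _ => set0); split.
apply: contrapT => nex.
have [mA pA disj] := dA.
have /choice[F FE] : forall i : 'I_n, exists F : Lr mu r,
    Lr_fun F = step_fun A (fun j : 'I_n => (j == i)%:R) %[ae mu].
  move=> i; apply: Lr_class; [exact: (measurable_step_fun dA _)|].
  exact: (finite_norm_step_fun r0 dA _).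
have [g gF] := hinf F.
have mg := measurable_Lr_fun g.
have mlt t : measurable [set x | t < Lr_fun g x].
  by rewrite -[X in measurable X]setTI; apply: measurable_fun_ltr.
have /choice[c cE] : forall i : 'I_n, exists c,
    mu.-negligible (A i `&` [set x | Lr_fun g x != c]).
  move=> i; apply: ae_constant_on => [|t].
    move=> /(negligibleP mu (mA i)) Ai0.
    by have := pA _ (ltn_ord i); rewrite Ai0 ltxx.
  apply: contrapT => /not_orP[n1 n2]; apply: nex.
  apply: (pos_disjoint_split dA (ltn_ord i) (mlt t)) => //.
  apply: contra_not n2; apply: negligibleS => x [Aix /= gx]; split => //=.
  by apply/negP; rewrite -leNgt.
pose U := \big[setU/set0]_(i < n) A i.
have UP x : U x <-> exists i : 'I_n, A i x.
  rewrite /U -bigcup_mkord; split.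
    by move=> [i /= lt_in Aix]; exists (Ordinal lt_in).
  by move=> [i Aix]; exists (val i) => //=.
pose B k := [set x | (k.+1%:R^-1 <= `|Lr_fun g x|)%R] `\` U.
have mB k : measurable (B k).
  apply: measurableD; last by apply: bigsetU_measurable => i _; exact: mA.
  rewrite -[X in measurable X]setTI; apply: measurable_fun_ler => //.
  exact: measurableT_comp.
have B0 k : mu.-negligible (B k).
  apply: contrapT => nB; apply: nex.
  apply: (pos_disjoint_extend dA (mB k)).
    rewrite lt_neqAle measure_ge0 andbT; apply/andP; split.
      by apply/eqP => Bk0; apply: nB; apply/negligibleP.
    have : (mu [set x | (k.+1%:R^-1 <= `|Lr_fun g x|)%R] < +oo)%E.
      apply: (Lr_superlevel_lty r0) => //.
      exact: (proj2_sig g).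
    apply: le_lt_trans; apply: le_measure; rewrite ?inE//; last exact: subDsetl.
    rewrite -[X in measurable X]setTI; apply: measurable_fun_ler => //.
    exact: measurableT_comp.
  move=> i lt_in; apply/seteqP; split => // x [Aix [_ nU]].
  by apply: nU; apply/UP; exists (Ordinal lt_in).
apply: (gF c).
have aeB : \forall x \ae mu, forall k, ~ B k x.
  by apply: ae_foralln => k; apply: negligibleS (B0 k) => x /contrapT.
have aec : \forall x \ae mu, forall i : 'I_n, A i x -> Lr_fun g x = c i.
  apply: filter_forall => i; apply: negligibleS (cE i) => x /= /not_implyP[Aix gx].
  by split => //; apply/eqP.
have aeF := filter_forall (ae_filter_ringOfSetsType mu) FE.
apply: filterS3 aeB aec aeF => x Bx cx Fx _.
under eq_bigr do rewrite Fx//.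
have [[i Aix]|nA] := pselect (exists i : 'I_n, A i x).
  rewrite (cx _ Aix) (bigD1 i)//= (step_fun_in dA _ Aix) eqxx mulr1 big1 ?addr0// => j ji.
  by rewrite (step_fun_in dA _ Aix) eq_sym (negbTE ji) mulr0.
rewrite big1; last first.
  by move=> i _; rewrite step_fun_out ?mulr0// => j Ajx; apply: nA; exists j.
apply: contrapT => /eqP gx.
have [|k kx] := @exists_invn_lt _ `|Lr_fun g x|; first by rewrite normr_gt0.
by apply: (Bx k); split => /=; [exact: ltW|move/UP].
Qed.

Lemma Lr_embedding (I : finType) : exists e : (I -> R) -> Lr mu r,
  forall u v, (Lr_dist (e u) (e v) `^ r = (\sum_i `|u i - v i| `^ r)%:E)%E.
Proof.
have [A dA] := exists_pos_disjoint #|I|.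
have [mA pA _] := dA.
(* This weight scales the indicator of [A i] so that its [r]-th power has integral 1. *)
pose w (i : 'I_#|I|) : R := (fine (mu (A i))) `^ (- r^-1).
have Aw i : ((w i `^ r)%:E * mu (A i) = 1)%E.
  have /andP[A0 Ay] := pA _ (ltn_ord i).
  have Af : mu (A i) \is a fin_num by rewrite ge0_fin_numE ?measure_ge0.
  have m0 : 0 < fine (mu (A i)) by rewrite fine_gt0// A0 Ay.
  rewrite -(fineK Af) -EFinM /w -powRrM mulNr mulVf ?gt_eqF//.
  by rewrite powR_inv1 ?(ltW m0)// mulVf// gt_eqF.
pose f (u : I -> R) := step_fun A (fun i : 'I_#|I| => u (enum_val i) * w i).
have /choice[e eE] : forall u, exists F : Lr mu r, Lr_fun F = f u %[ae mu].
  move=> u; apply: Lr_class; [exact: (measurable_step_fun dA _)|].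
  exact: (finite_norm_step_fun r0 dA _).
exists e => u v; rewrite powR_Lr_dist//.
transitivity (\int[mu]_x (`|f (u \- v) x| `^ r)%:E)%E.
  have fB x : f (u \- v) x = f u x - f v x.
    by rewrite /f /step_fun -sumrB; apply: eq_bigr => i _; rewrite !mulrBl.
  apply: ge0_ae_eq_integral => //.
  - apply/measurable_EFinP; apply: (@measurable_powR_norm _ _ _ r (fun x => _ - _)).
    by apply: measurable_funB; exact: measurable_Lr_fun.
  - apply/measurable_EFinP; apply: measurable_powR_norm.
    exact: (measurable_step_fun dA _).
  by apply: filterS2 (eE u) (eE v) => x eu ev _; rewrite fB eu// ev.
rewrite (integral_powR_step_fun r0 dA) (reindex_onto enum_rank enum_val)/=; last first.
  by move=> i _; exact: enum_valK.
rewrite -sumEFin; apply: eq_big => [i|i _]; first by rewrite enum_rankK eqxx.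
rewrite enum_rankK normrM powRM// [`|w _|]ger0_norm ?powR_ge0//.
by rewrite EFinM -muleA Aw mule1.
Qed.

End pos_disjoint_exist.

(** * The separation ratio *)

(** Passing to the supremum and infimum gives [kappa <= C * omega]. The degenerate cases agree with
    the conventions: [omega = 0] forces [kappa = 0] and the ratio 0, and [omega = +oo] also gives 0.
    The point [x] makes the suprema range over a nonempty set, so [omega >= 0]. *)
Lemma separation_ratio_le (R : realType) (M1 M2 : Type)
    (dist1 : M1 -> M1 -> \bar R) (dist2 : M2 -> M2 -> \bar R)
    (phi : M1 -> M2) (x : M1) (C : R) : 0 < C -> dist1 x x = 0%E ->
  (forall y z, 0 <= dist2 y z)%E ->
  (forall t t' : R, 0 < t -> 0 < t' ->
     (kappa_at dist1 dist2 phi t <= C%:E * omega_at dist1 dist2 phi t')%E) ->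
  (separation_ratio dist1 dist2 phi <= C%:E)%E.
Proof.
move=> C0 dx d20 H; rewrite /separation_ratio.
set k := kappa _ _ _; set w := omega _ _ _.
have k0 : (0 <= k)%E.
  apply: (@le_trans _ _ (kappa_at dist1 dist2 phi 1)).
    by apply: le_ereal_inf_tmp => _ [y _ <-].
  by apply: ereal_sup_ubound; exists 1 => /=.
have w0 : (0 <= w)%E.
  apply: le_ereal_inf_tmp => _ [t /= t0 <-].
  apply: (@le_trans _ _ (dist2 (phi x) (phi x))) => //.
  by apply: ereal_sup_ubound; exists (x, x) => //=; rewrite dx lee_fin ltW.
have kw : (k <= C%:E * w)%E.
  rewrite -lee_pdivrMl//; apply: le_ereal_inf_tmp => _ [t' /= t'0 <-].
  rewrite lee_pdivrMl//; apply: ge_ereal_sup => _ [t /= t0 <-].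
  exact: H.
case: w w0 kw => [w| |] //.
- rewrite lee_fin le_eqVlt => /predU1P[<-|w0].
    rewrite mule0 => k0'; have -> : k = 0%E by apply/eqP; rewrite eq_le k0' k0.
    by rewrite mul0e lee_fin ltW.
  by rewrite inver gt_eqF// lee_pdivrMr.
- by move=> _ _; rewrite invey mule0 lee_fin ltW.
Qed.

Lemma poweR_le_inv (R : realType) (r : R) (x y : \bar R) : 0 < r ->
  (0 <= x -> 0 <= y -> x `^ r <= y `^ r -> x <= y)%E.
Proof.
move=> r0 x0 y0 xy; rewrite -(poweRe1 x0) -(poweRe1 y0).
rewrite -(@mulfV _ r) ?gt_eqF// !poweRrM.
by apply: gt0_ler_poweR => //; rewrite ?invr_ge0 ?(ltW r0)// in_itv/= poweR_ge0 leey.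
Qed.

Lemma Lr_distxx d (T : measurableType d) (R : realType)
  (mu : {measure set T -> \bar R}) (r : R) (f : Lr mu r) :
  0 < r -> Lr_dist f f = 0%E.
Proof.
move=> r0; rewrite /Lr_dist (_ : EFin \o _ = cst 0%E) ?Lnorm0 ?eqe ?gt_eqF//.
by apply/funext => x /=; rewrite subrr.
Qed.

(** * Comparing the moduli of maps from [L_p] to [L_q] *)

Section Lp_to_Lq.
Context (R : realType) (d1 d2 : measure_display).
Context (T1 : measurableType d1) (T2 : measurableType d2).
Context (mu : {measure set T1 -> \bar R}) (nu : {measure set T2 -> \bar R}).
Variables p q : R.
Hypotheses (hp : 2 < p) (hq0 : 0 < q) (hq2 : q < 2).
Hypothesis hLp : Lr_infinite_dimensional mu p.

Let p0 : 0 < p. Proof. by apply: lt_trans hp; rewrite ltr0n. Qed.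

(** Scale [torus_map] by [t / l]. Under a jump one coordinate moves by [t]; under a step each of the
    [2 l^2] coordinates moves by at most [t / l], so the [p]-th power of the distance is at most
    [2 l^2 (t / l)^p], which the condition on [l] bounds by [t'^p]. *)
Lemma torus_embedding l t t' : 0 < t -> 0 < t' -> (0 < l)%N ->
  2 * (t / t') `^ p <= l%:R `^ (p - 2) ->
  exists psi : torus (l ^ 2) l -> Lr mu p,
    {in @jumps R _ (@torus_gen (l ^ 2) l) (l ^ 2) l, forall i,
      (t%:E <= Lr_dist (psi i.2.1) (psi i.2.2))%E} /\
    {in @steps R _ (@torus_gen (l ^ 2) l) (l ^ 2) l, forall i,
      (Lr_dist (psi i.2.1) (psi i.2.2) <= t'%:E)%E}.
Proof.
move=> t0 t'0 l0 lP; set n := (l ^ 2)%N.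
have [e eP] := Lr_embedding p0 hLp ('I_n * bool)%type.
have lr0 : 0 < l%:R :> R by rewrite ltr0n.
have s0 : 0 < t / l%:R by rewrite divr_gt0.
exists (fun x => e (fun i => t / l%:R * torus_map R x i)).
have eD x y : (Lr_dist (e (fun i => (t / l%:R * torus_map R x i)%R))
     (e (fun i => (t / l%:R * torus_map R y i)%R)) `^ p =
     (\sum_i (t / l%:R) `^ p * `|torus_map R x i - torus_map R y i| `^ p)%:E)%E.
  rewrite eP; congr EFin; apply: eq_bigr => i _.
  by rewrite -mulrBr normrM (gtr0_norm s0) powRM// ltW.
split=> i.
- move=> /mem_jumps[k kn ->]; apply: (@poweR_le_inv _ p) => //.
  + by rewrite lee_fin ltW.
  + exact: Lnorm_ge0.
  rewrite eD poweR_EFin lee_fin.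
  have [j jl] := torus_map_jump R l0 i.2.2 kn.
  rewrite (bigD1 j)//= jl -powRM ?(ltW s0)// divfK ?gt_eqF// lerDl.
  by apply: sumr_ge0 => m _; rewrite mulr_ge0 ?powR_ge0.
- move=> /mem_steps[k [g [_ gk ->]]]; apply: (@poweR_le_inv _ p) => //.
  + exact: Lnorm_ge0.
  + by rewrite lee_fin ltW.
  rewrite eD poweR_EFin lee_fin.
  apply: (@le_trans _ _ (\sum_(j : 'I_n * bool) (t / l%:R) `^ p)).
    apply: ler_sum => j _; rewrite ger_pMr ?powR_gt0//.
    rewrite distrC; apply: (@le_trans _ _ (1 `^ p)); last by rewrite powR1.
    by rewrite ge0_ler_powR ?nnegrE ?(ltW p0)// (torus_map_step R l0 _ _ gk).
  rewrite sumr_const card_prod card_ord card_bool.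
  have -> : (t / l%:R) `^ p = (t / t') `^ p * t' `^ p / l%:R `^ p.
    rewrite -powRM ?divr_ge0 ?(ltW t0) ?(ltW t'0)// divfK ?gt_eqF//.
    by rewrite powRM ?(ltW t0) ?invr_ge0// -[l%:R^-1]powR_inv1// -powRrM mulN1r powRN.
  rewrite -[_ *+ _]mulr_natr natrM /n natrX.
  rewrite [leLHS](_ : _ =
    2 * (t / t') `^ p * l%:R ^+ 2 / l%:R `^ p * t' `^ p); last by ring.
  rewrite ger_pMl ?powR_gt0// ler_pdivrMr ?powR_gt0// mul1r.
  apply: le_trans (ler_wpM2r _ lP) _; first exact: exprn_ge0.
  by rewrite -powR_mulrn// -powRD ?subrK// gt_eqF// implybT.
Qed.

Lemma kappa_at_le_omega_at (phi : Lr mu p -> Lr nu q) t t' : 0 < t -> 0 < t' ->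
  (kappa_at (@Lr_dist _ _ R mu p) (@Lr_dist _ _ R nu q) phi t <=
   (16 `^ q^-1)%:E * omega_at (@Lr_dist _ _ R mu p) (@Lr_dist _ _ R nu q) phi t')%E.
Proof.
have mul16 a b : (8 * (a + a) * b = a * b * 16)%N by lia.
move=> t0 t'0; set ka := kappa_at _ _ _ _; set om := omega_at _ _ _ _.
pose X := 2 * (t / t') `^ p.
have X0 : 0 < X by rewrite mulr_gt0 ?powR_gt0// divr_gt0.
(* Since [p - 2 > 0], a large [l] meets the condition of [torus_embedding]. *)
have [l' Xl'] := exists_natr_gt (X `^ (p - 2)^-1).
pose l := l'.+1; pose n := (l ^ 2)%N.
have p20 : 0 < p - 2 by rewrite subr_gt0.
have lX : X <= l%:R `^ (p - 2).
  rewrite [leLHS](_ : _ = (X `^ (p - 2)^-1) `^ (p - 2)); last first.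
    by rewrite -powRrM mulVf ?gt_eqF// powRr1// ltW.
  by rewrite ge0_ler_powR ?nnegrE ?powR_ge0 ?(ltW p20) ?(ltW Xl').
have [psi [psiJ psiS]] := torus_embedding t0 t'0 (ltn0Sn l') lX.
pose s := @torus_gen n l.
have ka0 : (0 <= ka)%E by apply: le_ereal_inf_tmp => _ [y _ <-]; exact: Lnorm_ge0.
have om0 : (0 <= om)%E.
  apply: (@le_trans _ _ (Lr_dist (phi (psi 0)) (phi (psi 0)))); first exact: Lnorm_ge0.
  apply: ereal_sup_ubound; exists (psi 0, psi 0) => //=.
  by rewrite Lr_distxx// lee_fin ltW.
have kaJ : {in jumps R s n l, forall i,
    (ka `^ q <= Lr_dist (phi (psi i.2.1)) (phi (psi i.2.2)) `^ q)%E}.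
  move=> i iJ; apply: gt0_ler_poweR; rewrite ?(ltW hq0)// ?in_itv/= ?leey ?ka0 ?andbT//.
    exact: Lnorm_ge0.
  by apply: ereal_inf_lbound; exists (psi i.2.1, psi i.2.2) => //=; exact: psiJ.
have omS : {in steps R s n l, forall i,
    (Lr_dist (phi (psi i.2.1)) (phi (psi i.2.2)) `^ q <= om `^ q)%E}.
  move=> i iS; apply: gt0_ler_poweR; rewrite ?(ltW hq0)// ?in_itv/= ?leey ?om0 ?andbT//.
    exact: Lnorm_ge0.
  by apply: ereal_sup_ubound; exists (psi i.2.1, psi i.2.2) => //=; exact: psiS.
pose K (w : T2) x y := `|Lr_fun (phi (psi x)) w - Lr_fun (phi (psi y)) w| `^ q.
have mK x y : measurable_fun setT (fun w => K w x y).
  apply: (@measurable_powR_norm _ _ _ q (fun w => _ - _)).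
  by apply: measurable_funB; exact: measurable_Lr_fun.
have K0 w x y : 0 <= K w x y by exact: powR_ge0.
have KE x y : (\int[nu]_w (K w x y)%:E = Lr_dist (phi (psi x)) (phi (psi y)) `^ q)%E.
  by rewrite powR_Lr_dist.
(* At a fixed [w] the composite is a real function on the torus, so the scalar inequality applies;
   integrating over [w] then yields [q]-th powers of distances in [L_q]. *)
have le_w w : wsum (jumps R s n l) (K w) <= wsum (steps R s n l) (K w).
  apply: (wsum_powR_le hq0 hq2 (jumps_nonneg _ _ _ _) (steps_nonneg _ _ _ _)
    _ (fun x => Lr_fun (phi (psi x)) w)).
  exact: wsum_jumps_steps_sqr.
have := integral_wsum_le nu mK K0 (jumps_nonneg _ _ _ _) (steps_nonneg _ _ _ _) le_w.
under eq_bigr do rewrite KE.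
under [leRHS]eq_bigr do rewrite KE.
move=> leJS.
pose D x y := (Lr_dist (phi (psi x)) (phi (psi y)) `^ q)%E.
have lo := @wsum_ge_cst _ _ _ D _ (jumps_nonneg _ _ _ _) kaJ.
have hi := @wsum_le_cst _ _ _ D _ (steps_nonneg _ _ _ _) omS.
have := le_trans lo (le_trans leJS hi).
rewrite wsum_jumps1 wsum_steps1.
rewrite -[(l ^ 2)%N]/n mul16.
(* The common mass, [n] times the order of the torus, is finite and positive, so it cancels even
   when [om] is infinite. *)
rewrite [(_ * 16)%:R]natrM EFinM -muleA lee_pmul2l//; last first.
  rewrite lte_fin ltr0n muln_gt0 expn_gt0/=.
  by apply/card_gt0P; exists 0.
move=> le16; apply: (@poweR_le_inv _ q) => //.
  by rewrite mule_ge0// lee_fin powR_ge0.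
rewrite poweRM ?lee_fin ?powR_ge0// poweR_EFin -powRrM mulVf ?gt_eqF//.
by rewrite powRr1.
Qed.

End Lp_to_Lq.

Theorem corollary5p12 (R : realType) (d1 d2 : measure_display)
    (T1 : measurableType d1) (T2 : measurableType d2)
    (mu : {measure set T1 -> \bar R}) (nu : {measure set T2 -> \bar R})
    (p q : R) (hp : 2 < p) (hq0 : 0 < q) (hq2 : q < 2)
    (hLp : Lr_infinite_dimensional mu p) (hLq : Lr_infinite_dimensional nu q) :
  (coarse_embeddability_ratio (@Lr_dist d1 T1 R mu p) (@Lr_dist d2 T2 R nu q)
     <= (30 `^ (2 / q))%:E)%E.
Proof.
have p0 : 0 < p by apply: lt_trans hp; rewrite ltr0n.
apply: ge_ereal_sup => _ [phi _ <-].
(* This only supplies a base point of [L_p]. *)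
have [e _] := Lr_embedding p0 hLp unit.
apply: (@le_trans _ _ (16 `^ q^-1)%:E).
  apply: (separation_ratio_le (x := e (fun _ => 0))).
  - by rewrite powR_gt0.
  - exact: Lr_distxx.
  - by move=> y z; exact: Lnorm_ge0.
  - by move=> t t' t0 t'0; exact: kappa_at_le_omega_at.
rewrite lee_fin; apply: (@le_trans _ _ (30 `^ q^-1)).
  by rewrite ge0_ler_powR ?nnegrE ?invr_ge0 ?(ltW hq0)//; lra.
by rewrite ler_powR ?ler1n// ler_peMl ?invr_ge0 ?(ltW hq0)// ler1n.
Qed.
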